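(* Let $X$ be a pseudocompact Hausdorff space and let $Y$ be a metrizable topological vector space, equipped with a uniformity $\mathcal{U}$ inducing its topology. Then the topology on $C(X,Y)$ induced by the uniformity $\hat{\mathcal{U}}$ of uniform convergence coincides with the $C$-compact-open topology on $C(X,Y)$, and it depends only on the topology induced on $Y$ by the uniformity $\mathcal{U}$.
   Context: $C(X,Y)$ is the set of all continuous maps from $X$ to $Y$, where $Y$ carries the topology induced by $\mathcal{U}$. The uniformity $\hat{\mathcal{U}}$ of uniform convergence on $C(X,Y)$ is the one generated by the family of sets $\hat{V}=\{(f,g): (f(x),g(x))\in V \text{ for every } x\in X\}$, $V\in\mathcal{U}$. A subset $A\subseteq X$ is $C$-compact if $f(A)$ is compact for every continuous $f:X\to\mathbb{R}$. Pseudocompactness of $X$ is the same as $X$ being a $C$-compact subset of itself. The $C$-compact-open topology on $C(X,Y)$ is the topology generated by the base consisting of the sets $\bigcap_{i=1}^{k}[A_i,U_i]$, where each $A_i$ is a $C$-compact subset of $X$, each $U_i$ is an open subset of $Y$, and $[A,U]=\{f\in C(X,Y): f(A)\subseteq U\}$. *)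

(* Defs.v *)
From HB Require Import structures.
From mathcomp Require Import all_boot all_order all_algebra.
From mathcomp Require Import all_classical all_reals all_analysis.

Set Implicit Arguments.
Unset Strict Implicit.
Unset Printing Implicit Defensive.

Import Order.TTheory GRing.Theory Num.Theory.
Import numFieldNormedType.Exports.

Local Open Scope classical_set_scope.
Local Open Scope ring_scope.

(* A uniformity is kept as a plain set system, with the axioms of the library's
   [Uniform] structure as hypotheses, so that several uniformities can be
   considered on one carrier. *)
Record is_uniformity {T : Type} (E : set_system (T * T)) : Prop := {
  uniformity_filter : Filter E;
  uniformity_diagonal : forall V, E V -> diagonal `<=` V;
  uniformity_inv : forall V, E V -> E (V^-1)%relation;
  uniformity_split :
    forall V, E V -> exists2 W, E W & (W \; W `<=` V)%relation }.

(* [nbhs_ E x] is the filter generated by the sections of the V in E at x. *)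
Definition induces_topology (T : topologicalType) (E : set_system (T * T)) :=
  nbhs_ E = nbhs :> (T -> set_system T).

Definition uniformity_open {T : Type} (E : set_system (T * T)) :
  set_system T := [set O | forall x, O x -> nbhs_ E x O].

Record is_metric {R : realType} {T : Type} (d : T -> T -> R) : Prop := {
  metric_refl : forall x, d x x = 0;
  metric_separated : forall x y, d x y = 0 -> x = y;
  metric_symmetric : forall x y, d x y = d y x;
  metric_triangular : forall y x z, d x z <= d x y + d y z }.

Definition metrizable (R : realType) (T : topologicalType) :=
  exists2 d : T -> T -> R, is_metric d &
    forall x : T, nbhs x = nbhs_ball_ (fun y e => [set z | d y z < e]) x.

Definition C_compact (R : realType) {X : topologicalType} (A : set X) :=
  forall f : X -> R, continuous f -> compact (f @` A).

Definition pseudocompact (R : realType) (X : topologicalType) :=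
  C_compact R [set: X].

Section function_space_topologies.
Variables X Y : topologicalType.

Definition hat (V : set (Y * Y)) :
    set (continuousType X Y * continuousType X Y) :=
  [set fg : continuousType X Y * continuousType X Y |
    forall x, V (fg.1 x, fg.2 x)].

(* Since hat (V `&` W) = hat V `&` hat W, the supersets of the sets hat V
   already form the generated uniformity: see [unif_conv_smallest] and
   [unif_conv_uniformity] below. *)
Definition unif_conv (U : set_system (Y * Y)) :
  set_system (continuousType X Y * continuousType X Y) := filter_from U hat.

Definition set_open (A : set X) (O : set Y) : set (continuousType X Y) :=
  [set f | f @` A `<=` O].

Definition C_compact_open_base (R : realType) :
    set_system (continuousType X Y) :=
  [set B | exists k (A : 'I_k -> set X) (O : 'I_k -> set Y),
    (forall i, C_compact R (A i) /\ open (O i)) /\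
    B = \bigcap_i set_open (A i) (O i)].

Definition C_compact_open (R : realType) : set_system (continuousType X Y) :=
  [set \bigcup_(B in D) B | D in [set D | D `<=` C_compact_open_base R]].

Lemma unif_conv_filter (U : set_system (Y * Y)) :
  Filter U -> Filter (unif_conv U).
Proof.
move=> FU; apply: filter_from_filter; first by exists setT; exact: filterT.
move=> V W UV UW; exists (V `&` W); first exact: filterI.
by move=> fg VW; split=> x; have [] := VW x.
Qed.

Lemma unif_conv_smallest (U : set_system (Y * Y)) : Filter U ->
  unif_conv U = smallest (fun F => Filter F) (hat @` U).
Proof.
move=> FU; rewrite eqEsubset; split=> [P [V UV VP] F [FF UF]|P].
  by apply: filterS VP _; apply: UF; exists V.
apply; split; first exact: unif_conv_filter.
by move=> _ [V UV <-]; exists V.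
Qed.

Lemma unif_conv_uniformity (U : set_system (Y * Y)) :
  is_uniformity U -> is_uniformity (unif_conv U).
Proof.
case=> FU Ud Ui Us; split.
- exact: unif_conv_filter.
- move=> P [V UV VP] [f g] /= fg; apply: VP => x /=.
  by apply: (Ud _ UV); rewrite /diagonal /= in fg *; rewrite fg.
- by move=> P [V UV VP]; exists (V^-1)%relation; [exact: Ui|move=> fg h; exact: VP].
- move=> P [V UV VP]; have [W UW WV] := Us _ UV.
  exists (hat W); first by exists W.
  move=> [f g] [h fh hg]; apply: VP => x; apply: WV; exists (h x).
    exact: fh.
  exact: hg.
Qed.

End function_space_topologies.

Arguments unif_conv X {Y} U.
Arguments C_compact_open X Y R : clear implicits.

(* Main.v *)
Require Import Defs.
From HB Require Import structures.
From mathcomp Require Import all_boot all_order all_algebra.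
From mathcomp Require Import all_classical all_reals all_analysis.
From mathcomp Require Import lra.

Set Implicit Arguments.
Unset Strict Implicit.
Unset Printing Implicit Defensive.

Import Order.TTheory GRing.Theory Num.Theory.
Import numFieldNormedType.Exports.

Local Open Scope classical_set_scope.
Local Open Scope ring_scope.

(** Why the theorem is true.  Let d be a metric on Y.  On a C-compact set A, a
    continuous map f into Y behaves as if f(A) were compact, and three classical
    consequences of compactness are all that is used: sequences of A have
    d-cluster points along f ([C_compact_cluster]), f(A) is totally bounded
    ([C_compact_totally_bounded]), and open covers of f(A) have Lebesgue numbers
    ([C_compact_lebesgue]).  They come from a single kind of test function, the
    distance to a sequence with a vanishing penalty on its terms
    ([penalized_dist]).

    The C-compact-open topology is coarser than that of uniform convergence:
    when f(A) lies in an open set O, total boundedness and a Lebesgue number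
    reduce the choice of an entourage V with V[f(A)] inside O to finitely many
    points of A ([C_compact_open_entourage]).

    It is finer when X is pseudocompact: given an entourage V, let r be such that
    the r-balls around the points of f(X) are V-small, cover f(X) by finitely
    many balls of radius r/2, and take for A_i the closure of the preimage of the
    i-th small ball and for O_i the ball of radius r with the same centre.  The
    intersection of the [A_i, O_i] contains f and its elements are V-close to f
    ([C_compact_open_base_hat]).  The crux is that A_i is C-compact:
    in a pseudocompact space, the closure of a cozero set is C-compact
    ([pseudocompact_closure_cozero]).

    So the topology of uniform convergence equals one whose definition mentions
    only the topology of Y, whence its independence of the uniformity. *)

Lemma near_natSinv_lt (R : realType) (e : R) : 0 < e ->
  exists N, forall n, (N <= n)%N -> n.+1%:R^-1 < e.
Proof.
by move=> e0; have [N _ NP] := near_infty_natSinv_lt (PosNum e0); exists N.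
Qed.

(** * Distance to a sequence, with penalties *)

Section metric.
Context {R : realType} {Y : Type} {d : Y -> Y -> R}.
Hypothesis dmetric : is_metric d.

Lemma metric_ge0 (y z : Y) : 0 <= d y z.
Proof.
have := metric_triangular dmetric z y y.
rewrite (metric_refl dmetric) (metric_symmetric dmetric z y); lra.
Qed.

(** The distance from [y] to the terms of [s], where reaching the [n]-th term
    costs [w n] more.  With positive penalties tending to 0, it comes close to 0
    along [s] but vanishes only at the cluster points of [s]. *)
Definition penalized_dist (w : nat -> R) (s : nat -> Y) (y : Y) : R :=
  inf (range (fun n => w n + d y (s n))).

Section penalized.
Variables (w : nat -> R) (s : nat -> Y).
Hypothesis w_gt0 : forall n, 0 < w n.

Let penalized_lb y : lbound (range (fun n => w n + d y (s n))) 0.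
Proof. by move=> _ [n _ <-]; rewrite addr_ge0 ?metric_ge0// ltW. Qed.

Let penalized_neq0 y : range (fun n => w n + d y (s n)) !=set0.
Proof. by exists (w 0%N + d y (s 0%N)); exists 0%N. Qed.

Lemma penalized_dist_ge0 y : 0 <= penalized_dist w s y.
Proof. exact: lb_le_inf. Qed.

Lemma penalized_dist_le y n : penalized_dist w s y <= w n + d y (s n).
Proof. by apply: ge_inf; [exists 0|exists n]. Qed.

Lemma penalized_dist_at n : penalized_dist w s (s n) <= w n.
Proof.
by rewrite (le_trans (penalized_dist_le _ n))// (metric_refl dmetric) addr0.
Qed.

(** An infimum of 1-Lipschitz functions is 1-Lipschitz. *)
Lemma penalized_dist_lip y z :
  `|penalized_dist w s y - penalized_dist w s z| <= d y z.
Proof.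
wlog suff half : y z / penalized_dist w s y - d y z <= penalized_dist w s z.
  rewrite ler_norml; have := half y z; have := half z y.
  by rewrite (metric_symmetric dmetric z y); lra.
apply: lb_le_inf => // _ [n _ <-].
have := penalized_dist_le y n.
by have := metric_triangular dmetric z y (s n); lra.
Qed.

(** The first [N] penalties are bounded away from 0, so that an infimum equal to
    0 can only be approached by later terms. *)
Lemma penalized_dist0_cluster y : penalized_dist w s y = 0 ->
  forall (e : R) (N : nat), 0 < e -> exists2 n, (N <= n)%N & d y (s n) < e.
Proof.
move=> y0 e N e0.
have [m m0 mw] : exists2 m : R, 0 < m & forall n, (n < N)%N -> m <= w n.
  elim: N => [|N [m m0 mw]]; first by exists 1.
  exists (Num.min m (w N)); first by rewrite lt_min m0 w_gt0.
  move=> n; rewrite ltnS leq_eqVlt => /orP[/eqP ->|/mw mn].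
    by rewrite ge_min lexx orbT.
  by rewrite ge_min mn.
have em0 : 0 < Num.min e m by rewrite lt_min e0.
have [|_ [n _ <-]] := inf_lt (penalized_neq0 y) (_ : _ < Num.min e m).
  by rewrite [X in X < _]y0.
rewrite lt_min => /andP[ne nm]; exists n.
  rewrite leqNgt; apply/negP => /mw; have := metric_ge0 y (s n); lra.
by have := w_gt0 n; lra.
Qed.

Lemma penalized_dist_continuous (X : topologicalType) (f : X -> Y) :
  (forall x (e : R), 0 < e -> \forall x' \near x, d (f x) (f x') < e) ->
  continuous (penalized_dist w s \o f).
Proof.
move=> fc x; apply/cvgrPdist_lt => e e0; near=> x'.
apply: le_lt_trans (penalized_dist_lip _ _) _; near: x'; exact: fc.
Unshelve. all: end_near. Qed.

End penalized.

(** * Continuous images of C-compact sets in a metric space *)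

Section C_compact_metric.
Variables (X : topologicalType) (A : set X) (f : X -> Y).
Hypothesis CA : C_compact R A.
Hypothesis fc : forall x (e : R), 0 < e ->
  \forall x' \near x, d (f x) (f x') < e.

(** The distance to [f \o s] with penalties [1/(n+1)] is a continuous real
    function that comes arbitrarily close to 0 on [A]; its image of [A] is closed,
    so it vanishes at some point of [A]. *)
Lemma C_compact_cluster (s : nat -> X) : (forall n, A (s n)) ->
  exists2 x, A x &
    forall (e : R) (N : nat), 0 < e ->
      exists2 n, (N <= n)%N & d (f x) (f (s n)) < e.
Proof.
move=> As; pose w n : R := n.+1%:R^-1.
have w0 n : 0 < w n by rewrite invr_gt0.
pose t := penalized_dist w (f \o s).
have : closed (t @` (f @` A)).
  apply: compact_closed; first exact: Rhausdorff.
  rewrite image_comp; apply: CA.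
  exact: penalized_dist_continuous.
move=> /(_ 0)[|_ [x Ax <-] tx]; last first.
  by exists x => // e N e0; exact: penalized_dist0_cluster.
move=> B /nbhs_ballP[e /= e0 eB].
have [n /(_ n (leqnn n)) ne] := near_natSinv_lt e0; exists (t (f (s n))); split.
  by exists (f (s n)) => //; exists (s n).
apply: eB; rewrite /ball/= sub0r normrN ger0_norm ?penalized_dist_ge0//.
exact: le_lt_trans (penalized_dist_at _ w0 n) ne.
Qed.

(** Otherwise a sequence of [A] with [e]-separated images could be built greedily,
    and two of its terms would have images within [e/2] of that of a cluster
    point. *)
Lemma C_compact_totally_bounded (e : R) : 0 < e ->
  exists2 t : seq X, (forall a, a \in t -> A a) &
    forall x, A x -> exists2 a, a \in t & d (f a) (f x) < e.
Proof.
move=> e0; apply: contrapT => noT.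
have far (t : seq X) : (forall a, a \in t -> A a) ->
    exists2 x, A x & forall a, a \in t -> e <= d (f a) (f x).
  move=> tA; apply: contrapT => nofar; apply: noT; exists t => // x Ax.
  apply: contrapT => nox; apply: nofar; exists x => // a ta.
  by rewrite leNgt; apply/negP => ax; apply: nox; exists a.
have [//|x0 _ _] := far [::].
have /choice[g gP] (t : seq X) : exists x, (forall a, a \in t -> A a) ->
    A x /\ forall a, a \in t -> e <= d (f a) (f x).
  have [/far[x Ax tx]|nt] := pselect (forall a, a \in t -> A a).
    by exists x.
  by exists x0.
(* L n lists the first n terms of the sequence, the last one in front. *)
pose L := fix L n := if n is m.+1 then g (L m) :: L m else [::].
have LA n a : a \in L n -> A a.
  elim: n a => [//|n IH] a /=; rewrite in_cons => /orP[/eqP ->|/IH//].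
  by have [] := gP _ IH.
have sL m n : (m < n)%N -> g (L m) \in L n.
  elim: n => [//|n IH]; rewrite ltnS leq_eqVlt => /orP[/eqP ->|/IH] /=.
    by rewrite mem_head.
  by rewrite in_cons => ->; rewrite orbT.
have [n|x _ xP] := @C_compact_cluster (fun n => g (L n)).
  by have [] := gP _ (LA n).
have e20 : 0 < e / 2 by lra.
have [m _ xm] := xP _ 0%N e20; have [n mn xn] := xP _ m.+1 e20.
have [_ /(_ _ (sL _ _ mn))] := gP _ (LA n).
have := metric_triangular dmetric (f x) (f (g (L m))) (f (g (L n))).
by rewrite (metric_symmetric dmetric (f (g (L m))) (f x)); lra.
Qed.

(** A Lebesgue number lemma, where [G] is the family of sets regarded as small,
    such as the subsets of the members of an open cover.  If no radius [1/(n+1)]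
    were suitable, the centres of balls that are not small would cluster at a
    point around which some ball is small. *)
Lemma C_compact_lebesgue (G : set (set Y)) :
  (forall S T, S `<=` T -> G T -> G S) ->
  (forall x, A x -> exists2 r : R, 0 < r & G [set y | d (f x) y < r]) ->
  exists2 r : R, 0 < r & forall x, A x -> G [set y | d (f x) y < r].
Proof.
move=> Gsub Gloc; apply: contrapT => noR.
have /choice[s sP] n : exists x, A x /\ ~ G [set y | d (f x) y < n.+1%:R^-1].
  apply: contrapT => nox; apply: noR; exists n.+1%:R^-1.
    by rewrite invr_gt0.
  by move=> x Ax; apply: contrapT => xG; apply: nox; exists x.
have [n|x Ax xP] := @C_compact_cluster s; first by have [] := sP n.
have [r r0 xr] := Gloc _ Ax.
have r20 : 0 < r / 2 by lra.
have [N NP] := near_natSinv_lt r20.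
have [n Nn xn] := xP _ N r20.
have [_] := sP n; apply; apply: Gsub xr => y /= sy.
have := lt_trans sy (NP n Nn).
by have := metric_triangular dmetric (f (s n)) (f x) y; lra.
Qed.

End C_compact_metric.

End metric.

Arguments penalized_dist {R Y} d w s y.

(** * Closures of cozero sets *)

Lemma real_is_metric (R : realType) : is_metric (fun x y : R => `|x - y|).
Proof.
split=> [x|x y|x y|y x z].
- by rewrite subrr normr0.
- by move=> /eqP; rewrite normr_eq0 subr_eq0 => /eqP.
- exact: distrC.
- exact: ler_distD.
Qed.

(** Let [U] be the cozero set.  As [range g] is compact, only the closedness of
    the image of [closure U] under [g] is at stake.  If [r] were adherent to that
    image without belonging to it, [phi := |g - r|] would be positive on
    [closure U] and tend to 0 along some sequence [u] of [U].  With the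
    penalties [h (u n) / (n+1)], the distance [t] from [phi] to [phi \o u] is
    then positive on [closure U], so that [h / t], which is 0 off [closure U], is
    continuous.  But [h / t] is at least [n+1] at [u n], whereas continuous
    functions on [X] are bounded. *)
Lemma pseudocompact_closure_cozero (R : realType) (X : topologicalType)
    (h : X -> R) :
  pseudocompact R X -> continuous h -> C_compact R (closure [set x | 0 < h x]).
Proof.
move=> Xpc; wlog h0 : h / forall x, 0 <= h x => [wlog hc|].
  (* h + |h| is twice the positive part of h. *)
  have -> : [set x | 0 < h x] = [set x | 0 < h x + `|h x|].
    apply/seteqP; split=> x /=; case: (ltrP 0 (h x)) => // hx.
      by rewrite (gtr0_norm hx); lra.
    by rewrite (ler0_norm hx); lra.
  apply: wlog => x; first by have := ler_norm (- h x); rewrite normrN; lra.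
  by apply: cvgD; [exact: hc|apply: cvg_norm; exact: hc].
move=> hc g gc; set U := [set x | 0 < h x].
have gXc : compact (range g) by exact: Xpc.
apply: (subclosed_compact _ gXc); last by move=> _ [x _ <-]; exists x.
move=> r clr; apply: contrapT => nr.
pose phi x : R := `|g x - r|.
have phic : continuous phi.
  by move=> x; apply: cvg_norm; apply: cvgB; [exact: gc|exact: cvg_cst].
have phi_gt0 x : closure U x -> 0 < phi x.
  move=> clx; rewrite normr_gt0 subr_eq0; apply/eqP => gxr.
  by apply: nr; exists x.
have /choice[u uP] n : exists u, U u /\ phi u < n.+1%:R^-1.
  have e0 : 0 < n.+1%:R^-1 :> R by rewrite invr_gt0.
  have [_ [[x clx <-] rx]] := clr _ (nbhsx_ballx r _ e0).
  have : nbhs x [set z | phi z < n.+1%:R^-1].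
    by apply: (cvgr_lt (phi x) (phic x)); rewrite /phi distrC.
  by move=> /clx[z [Uz /= zn]]; exists z.
have Rm := real_is_metric R.
pose w n := h (u n) / n.+1%:R.
have w0 n : 0 < w n by rewrite divr_gt0//; have [] := uP n.
pose t x := penalized_dist (fun x y : R => `|x - y|) w (phi \o u) (phi x).
have tc : continuous t.
  apply: (penalized_dist_continuous Rm w0) => x e e0.
  by move/cvgrPdist_lt: (phic x); exact.
have t_gt0 x : closure U x -> 0 < t x.
  move=> /phi_gt0 px; rewrite lt_neqAle penalized_dist_ge0// andbT.
  apply/eqP => /esym tx.
  have px2 : 0 < phi x / 2 by lra.
  have [N NP] := near_natSinv_lt px2.
  have [n /NP nx] := penalized_dist0_cluster Rm w0 tx N px2.
  have un := lt_trans (uP n).2 nx.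
  by rewrite ltr_norml => /andP[]; rewrite /=; lra.
have Fc : continuous (fun x => h x / t x).
  move=> x; have [clx|nclx] := pselect (closure U x).
    apply: cvgM; first exact: hc.
    by apply: cvgV; [rewrite gt_eqF// t_gt0|exact: tc].
  have ox : nbhs x (~` closure U).
    apply: open_nbhs_nbhs; split=> //.
    by apply: closed_openC; exact: closed_closure.
  have hx z : (~` closure U) z -> h z = 0.
    move=> ncz; apply/eqP; rewrite eq_le h0 andbT leNgt; apply/negP => hz.
    exact/ncz/subset_closure.
  apply: cvg_near_cst; near=> z.
  by rewrite !hx ?mul0r//; near: z.
(* Only the numbers strictly above M are known to bound h / t, and M may be
   negative: hence the choice of n, for which n.+1 exceeds such a number. *)
have [M [_ MP]] := compact_bounded (Xpc _ Fc).
pose n := Num.truncn (Num.max M 0 + 1).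
have MM : M < Num.max M 0 + 1.
  by rewrite (@le_lt_trans _ _ (Num.max M 0)) ?ltrDl// le_max lexx.
have : Num.max M 0 + 1 < n.+1%:R by rewrite truncnS_gt.
have /(_ (h (u n) / t (u n))) := MP _ MM.
move=> /(_ (ex_intro2 _ _ (u n) I erefl)) Fn; apply/negP; rewrite -leNgt.
apply: le_trans Fn; apply: le_trans (ler_norm _).
have [Un _] := uP n.
rewrite ler_pdivlMr ?t_gt0//; last exact: subset_closure.
have := penalized_dist_at Rm (phi \o u) w0 n.
by rewrite /w ler_pdivlMr// mulrC.
Unshelve. all: end_near. Qed.

(** * Uniform convergence and C-compact sets *)

Section uniform_convergence.
Context {R : realType} {X Y : topologicalType} {d : Y -> Y -> R}.
Hypothesis dmetric : is_metric d.
Hypothesis nbhsd : forall y : Y,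
  nbhs y = nbhs_ball_ (fun y e => [set z | d y z < e]) y.

Lemma nbhs_metric_ball (y : Y) (e : R) : 0 < e -> nbhs y [set z | d y z < e].
Proof. by move=> e0; rewrite nbhsd; exists e. Qed.

Lemma open_metric_ball (y : Y) (e : R) : open [set z | d y z < e].
Proof.
rewrite openE => z /= yz; rewrite /interior nbhsd.
exists (e - d y z); first by rewrite /= subr_gt0.
by move=> u /= zu; have := metric_triangular dmetric z y u; lra.
Qed.

Lemma continuous_metric (f : X -> Y) : continuous f ->
  forall x (e : R), 0 < e -> \forall x' \near x, d (f x) (f x') < e.
Proof. by move=> fc x e e0; exact: (fc x _ (nbhs_metric_ball (f x) e0)). Qed.

Lemma continuous_dist (f : X -> Y) (y : Y) : continuous f ->
  continuous (fun x => d y (f x)).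
Proof.
move=> fc x; apply/cvgrPdist_lt => e e0; near=> x'.
have : d (f x) (f x') < e by near: x'; exact: continuous_metric.
have := metric_triangular dmetric (f x) y (f x').
have := metric_triangular dmetric (f x') y (f x).
rewrite (metric_symmetric dmetric (f x') (f x)) ltr_norml.
by move=> ? ? ?; apply/andP; split; lra.
Unshelve. all: end_near. Qed.

Context {U : set_system (Y * Y)}.
Hypothesis Uunif : is_uniformity U.
Hypothesis Utop : induces_topology U.

Lemma nbhs_xsection V y : U V -> nbhs y (xsection V y).
Proof. by move=> UV; rewrite -Utop; exists V. Qed.

(** A set [S] is small here when one entourage [V] satisfies [V[S] `<=` O].  A
    Lebesgue number [r] makes each ball of radius [r] centred in [f @` A] small,
    and finitely many of these balls cover [f @` A]: the intersection of their
    entourages is suitable. *)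
Lemma C_compact_open_entourage (A : set X) (O : set Y) (f : X -> Y) :
  C_compact R A -> continuous f -> open O -> f @` A `<=` O ->
  exists2 V, U V & forall x, A x -> xsection V (f x) `<=` O.
Proof.
move=> CA fc oO fAO; have FU := uniformity_filter Uunif.
have fd := continuous_metric fc.
pose G := [set S : set Y | exists2 V, U V &
  forall y, S y -> xsection V y `<=` O].
have [|x Ax|r r0 Gr] := @C_compact_lebesgue _ _ _ dmetric _ _ _ CA fd G.
- by move=> S T ST [V UV TO]; exists V => // y /ST; exact: TO.
- have : nbhs (f x) O by apply: open_nbhs_nbhs; split=> //; apply: fAO; exists x.
  rewrite -{1}Utop => -[V UV VO]; have [W UW WV] := uniformity_split Uunif UV.
  have := nbhs_xsection (f x) UW; rewrite nbhsd => -[r r0 rW].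
  exists r => //; exists W => // y /rW /= /xsectionP xy z /xsectionP yz.
  by apply/VO/xsectionP/WV; exists y.
have [t tA At] := C_compact_totally_bounded dmetric CA fd r0.
have /choice[v vP] a : exists V, U V /\ (a \in t ->
    forall y, d (f a) y < r -> xsection V y `<=` O).
  have [ta|nta] := boolP (a \in t); last by exists setT; split=> //; exact: filterT.
  by have [V UV VO] := Gr a (tA a ta); exists V.
exists [set yz | forall i : 'I_(size t), v (tnth (in_tuple t) i) yz].
  by apply: filter_forall => i; exact: (vP _).1.
move=> x /At[a ta ax] z /xsectionP/= xz.
apply: ((vP a).2 ta (f x) ax); apply/xsectionP.
have ia : (index a t < size t)%N by rewrite index_mem.
by have := xz (Ordinal ia); rewrite (tnth_nth a)/= nth_index.
Qed.

(** [A i] is the closure of the preimage of the ball of radius [r/2] around the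
    [i]-th centre, hence [f] maps it into the ball [O i] of radius [r], which is
    [V]-small.  As the [A i] cover [X], a map [g] sending each [A i] into [O i]
    is everywhere [V]-close to [f]. *)
Lemma C_compact_open_base_hat (V : set (Y * Y)) (f : continuousType X Y) :
  pseudocompact R X -> U V ->
  exists2 B, C_compact_open_base R B & B f /\ B `<=` xsection (hat V) f.
Proof.
move=> Xpc UV; have FU := uniformity_filter Uunif.
have fc : continuous f by exact: cts_fun.
have fd := continuous_metric fc.
pose G := [set S : set Y | forall y z, S y -> S z -> V (y, z)].
have [|x _|r r0 Gr] := @C_compact_lebesgue _ _ _ dmetric _ _ _ Xpc fd G.
- by move=> S T ST GT y z /ST Ty /ST; exact: GT.
  (* W must be symmetric for the points of W[f x] to be V-close to each other. *)
- have [W UW WV] := uniformity_split Uunif UV.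
  have := nbhs_xsection (f x) (filterI UW (uniformity_inv Uunif UW)).
  rewrite nbhsd => -[r r0 rW]; exists r => // y z /rW /xsectionP[_ /= yx].
  by move=> /rW /xsectionP[/= xz _]; apply: WV; exists (f x).
have r20 : 0 < r / 2 by lra.
have [t _ tX] := C_compact_totally_bounded dmetric Xpc fd r20.
pose a i := tnth (in_tuple t) i.
pose h (i : 'I_(size t)) x := r / 2 - d (f (a i)) (f x).
pose A i := closure [set x | 0 < h i x].
pose O i := [set y | d (f (a i)) y < r].
have AO i : f @` A i `<=` O i.
  move=> _ [x Ax <-]; have [x' [/= ]] := Ax _ (fd x _ r20).
  rewrite /h => hx' xx'.
  have := metric_triangular dmetric (f x') (f (a i)) (f x).
  by rewrite (metric_symmetric dmetric (f x') (f x)) /O/=; lra.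
exists (\bigcap_i set_open (A i) (O i)).
  exists (size t), A, O; split=> // i; split; last exact: open_metric_ball.
  apply: pseudocompact_closure_cozero => // x.
  by apply: cvgB; [exact: cvg_cst|exact: continuous_dist].
split=> [i _|g gB]; first exact: AO.
apply/xsectionP => x /=; have [b tb bx] := tX x I.
have bt : (index b t < size t)%N by rewrite index_mem.
pose i := Ordinal bt.
have ab : a i = b by rewrite /a (tnth_nth b)/= nth_index.
have Ax : A i x.
  by apply: subset_closure; rewrite /= /h ab subr_gt0.
apply: (Gr b I); rewrite -ab; first by apply: (AO i); exists x.
by apply: (gB i I); exists x.
Qed.

(** The topology induced on [Y] is all that the right-hand side retains of [U]. *)
Lemma uniformity_open_C_compact_open : pseudocompact R X ->
  uniformity_open (unif_conv X U) = C_compact_open X Y R.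
Proof.
move=> Xpc; have FU := uniformity_filter Uunif.
rewrite eqEsubset; split=> [Q oQ|_ [D Dbase <-] f [B DB Bf]].
  exists [set B | C_compact_open_base R B /\ B `<=` Q]; first by move=> B [].
  rewrite eqEsubset; split=> [f [B [_ BQ] /BQ] //|f Qf].
  have [E [V UV VE] EQ] := oQ f Qf.
  have [B Bbase [Bf BV]] := C_compact_open_base_hat f Xpc UV.
  exists B => //; split=> // g /BV /xsectionP fg.
  by apply/EQ/xsectionP/VE.
have [k [A [Q [AQ Beq]]]] := Dbase B DB.
have /choice[v vP] i : exists V, U V /\
    forall x, A i x -> xsection V (f x) `<=` Q i.
  have [CA oQ] := AQ i.
  have [|V UV VO] := C_compact_open_entourage CA (@cts_fun _ _ f) oQ.
    by move: Bf; rewrite Beq => /(_ i I).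
  by exists V.
exists (hat [set yz | forall i, v i yz]).
  exists [set yz | forall i, v i yz] => //.
  by apply: filter_forall => i; exact: (vP i).1.
move=> g /xsectionP fg; exists B => //; rewrite Beq => i _ _ [x Ax <-].
by apply: ((vP i).2 x Ax); apply/xsectionP; exact: fg.
Qed.

End uniform_convergence.

Theorem corollary3p5 (R : realType) (K : numFieldType) (X : topologicalType)
    (Y : topologicalLmodType K) (U : set_system (Y * Y)) :
  hausdorff_space X -> pseudocompact R X -> metrizable R Y ->
  is_uniformity U -> induces_topology U ->
  uniformity_open (unif_conv X U) = C_compact_open X Y R /\
  (forall U' : set_system (Y * Y),
    is_uniformity U' -> induces_topology U' ->
    uniformity_open (unif_conv X U') = uniformity_open (unif_conv X U)).
Proof.
move=> _ Xpc [d dmetric nbhsd] Uunif Utop; split=> [|U' Uunif' Utop'].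
  exact: (uniformity_open_C_compact_open dmetric).
by rewrite !(uniformity_open_C_compact_open dmetric).
Qed.
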